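(* The randomized query complexity of finding a strong king in an $n$-vertex tournament is $\Theta(n^2)$; that is, $\mathsf{R}(\textsf{STRONG-KING}_n)=\Theta(n^2)$ for tournaments.
   Context: A tournament is a directed graph in which for every pair of distinct vertices $u,v$ exactly one of $u\to v$, $v\to u$ is an edge. An $n$-vertex tournament on vertex set $\{0,\dots,n-1\}$ is given as a string in $\{0,1\}^{\binom n2}$, one bit per unordered pair giving the direction of the edge. For vertices $u,v$, $\delta(u,v)$ denotes the number of directed paths of length $2$ from $u$ to $v$. A king is a vertex from which every other vertex is reachable by a directed path of length at most $2$; a strong king is a king $k$ such that for every vertex $w$ with $w\to k$ we have $\delta(k,w)>\delta(w,k)$. $\textsf{STRONG-KING}_n$ is the problem: given an $n$-vertex tournament, output a vertex $v$ such that for every $u$ with $u\to v$, $\delta(v,u)>\delta(u,v)$ (i.e. a strong king). In the query model an algorithm accesses the input only by querying bits; a randomized decision tree is a distribution over deterministic decision trees, and $\mathsf{R}(f)$ is the minimum, over randomized decision trees outputting a correct answer with probability at least $2/3$ on every input, of the maximum depth of a tree in the support. *)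

(* Defs.v *)
From HB Require Import structures.
From mathcomp Require Import all_boot all_order all_algebra.
From mathcomp Require Import finmap.
From mathcomp Require Import all_classical all_reals all_analysis.

Set Implicit Arguments.
Unset Strict Implicit.
Unset Printing Implicit Defensive.

Import Order.TTheory GRing.Theory Num.Theory.

Local Open Scope ring_scope.

Section DecisionTrees.
Variables (I O : Type).

Inductive dtree : Type :=
| Answer of O
| Query of I & dtree & dtree.

Fixpoint dtree_run (t : dtree) (x : I -> bool) : O :=
  match t with
  | Answer o => o
  | Query i t0 t1 => if x i then dtree_run t1 x else dtree_run t0 x
  end.

Fixpoint dtree_depth (t : dtree) : nat :=
  match t with
  | Answer _ => 0%N
  | Query _ t0 t1 => (maxn (dtree_depth t0) (dtree_depth t1)).+1
  end.

Fixpoint dtree_encode (t : dtree) : GenTree.tree (I + O) :=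
  match t with
  | Answer o => GenTree.Leaf (inr o)
  | Query i t0 t1 =>
      GenTree.Node 0 [:: GenTree.Leaf (inl i); dtree_encode t0; dtree_encode t1]
  end.

Fixpoint dtree_decode (g : GenTree.tree (I + O)) : option dtree :=
  match g with
  | GenTree.Leaf (inr o) => Some (Answer o)
  | GenTree.Node 0 [:: GenTree.Leaf (inl i); g0; g1] =>
      match dtree_decode g0, dtree_decode g1 with
      | Some t0, Some t1 => Some (Query i t0 t1)
      | _, _ => None
      end
  | _ => None
  end.

Lemma dtree_encodeK : pcancel dtree_encode dtree_decode.
Proof. by elim=> //= i t0 -> t1 ->. Qed.

End DecisionTrees.

HB.instance Definition _ (I O : choiceType) :=
  Choice.copy (dtree I O) (pcan_type (@dtree_encodeK I O)).

Section RandomizedQueryComplexity.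
Variables (R : realType) (I : finType) (O : choiceType).

(* Finite support is no restriction when O is finite: there are then finitely
   many trees of each depth, so every distribution on trees of bounded depth
   has finite support. *)
Record rdtree : Type := RDTree {
  rdtree_mass :> {fsfun dtree I O -> R with 0};
  rdtree_ge0 : forall t, 0 <= rdtree_mass t;
  rdtree_sum1 : \sum_(t <- finsupp rdtree_mass) rdtree_mass t = 1
}.

Definition rdtree_depth (T : rdtree) : nat :=
  (\max_(t <- finsupp T) dtree_depth t)%N.

(* A search problem relates an input to its correct answers, of which there may
   be several. *)
Definition search_problem : Type := {ffun I -> bool} -> pred O.

Definition success_prob (T : rdtree) (P : search_problem) (x : {ffun I -> bool}) : R :=
  \sum_(t <- finsupp T | P x (dtree_run t x)) T t.

Definition rdtree_solves (T : rdtree) (P : search_problem) : Prop :=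
  forall x, 2 / 3 <= success_prob T P x.

Definition solvable_in_depth (P : search_problem) (d : nat) : Prop :=
  exists2 T : rdtree, rdtree_solves T P & rdtree_depth T = d.

(* Set to 0 when no randomized tree solves P, i.e., when some input has no correct
   answer. *)
Definition rand_query_complexity (P : search_problem) : nat :=
  match pselect (exists d, `[< solvable_in_depth P d >]) with
  | left solvable => ex_minn solvable
  | right _ => 0%N
  end.

Lemma rand_query_complexityP (P : search_problem) :
  (exists T : rdtree, rdtree_solves T P) ->
  solvable_in_depth P (rand_query_complexity P) /\
  forall T : rdtree, rdtree_solves T P ->
    (rand_query_complexity P <= rdtree_depth T)%N.
Proof.
move=> [T0 solT0]; rewrite /rand_query_complexity.
case: pselect => [ex_d|[]]; last by exists (rdtree_depth T0); apply/asboolP; exists T0.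
case: ex_minnP => d /asboolP solvd d_min; split=> // T solT.
by apply: d_min; apply/asboolP; exists T.
Qed.

End RandomizedQueryComplexity.

Section Tournaments.
Variable n : nat.

Definition vpair : Type := {p : 'I_n * 'I_n | (p.1 < p.2)%N}.

HB.instance Definition _ := Finite.on vpair.

Lemma card_vpair : #|{: vpair}| = 'C(n, 2).
Proof.
rewrite card_sig -sum1_card (eq_bigl (fun p : 'I_n * 'I_n => predT p.1 && (p.1 < p.2)%N))//.
rewrite -(pair_big_dep predT (fun i j : 'I_n => (i < j)%N) (fun _ _ => 1%N)) /=.
rewrite (exchange_big_dep predT) //= -bin2_sum big_mkord.
apply: eq_bigr => j _.
rewrite (big_ord_narrow (ltnW (ltn_ord j)) (F := fun=> 1%N)).
by rewrite sum1_card card_ord.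
Qed.

(* The bit of {u, v} with u < v is true when u -> v and false when v -> u. *)
Definition tournament : Type := {ffun vpair -> bool}.

Implicit Types (G : tournament) (u v w k : 'I_n).

Definition arc G u v : bool :=
  match insub (u, v), insub (v, u) with
  | Some uv, _ => G uv
  | None, Some vu => ~~ G vu
  | None, None => false
  end.

Lemma arcxx G u : arc G u u = false.
Proof. by rewrite /arc insubF //= ltnn. Qed.

Lemma arc_antisym G u v : u != v -> arc G v u = ~~ arc G u v.
Proof.
rewrite -val_eqE /arc /= neq_ltn => u_neq_v.
case: insubP => [vu /= lt_vu _|/= nlt_vu]; case: insubP => [uv /= lt_uv _|/= nlt_uv] //.
- by have := ltn_trans lt_uv lt_vu; rewrite ltnn.
- by rewrite negbK.
- by move: u_neq_v; rewrite (negPf nlt_vu) (negPf nlt_uv).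
Qed.

Definition delta G u v : nat := #|[set w | arc G u w && arc G w v]|.

Definition king G k : bool :=
  [forall w, (w != k) ==> arc G k w || [exists m, arc G k m && arc G m w]].

Definition strong_king G k : bool :=
  king G k && [forall w, arc G w k ==> (delta G w k < delta G k w)%N].

End Tournaments.

Definition STRONG_KING (n : nat) : search_problem (vpair n) 'I_n :=
  fun G v => [forall u, arc G u v ==> (delta G u v < delta G v u)%N].

Lemma STRONG_KINGE (n : nat) (G : tournament n) (k : 'I_n) :
  STRONG_KING G k = strong_king G k.
Proof.
rewrite /STRONG_KING /strong_king andb_idl // => /forallP beats.
apply/forallP => w; apply/implyP => w_neq_k.
case: (boolP (arc G k w)) => //= not_kw; apply/existsP.
have /card_gt0P[m] : (0 < delta G k w)%N.
  have wk : arc G w k by rewrite (@arc_antisym _ G k w) // eq_sym.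
  exact: leq_ltn_trans (implyP (beats w) wk).
by rewrite inE => km_mw; exists m.
Qed.

(* Main.v *)
From Pilot Require Import Defs.
From mathcomp Require Import all_boot all_order all_algebra.
From mathcomp Require Import finmap zify lra.
From mathcomp Require Import all_classical all_reals all_analysis.

Import Order.TTheory GRing.Theory Num.Theory.
Import numFieldNormedType.Exports.
Import Pilot.Defs.

Local Open Scope classical_set_scope.
Local Open Scope ring_scope.

(* A vertex [v] is a strong king iff no in-neighbour of [v] has larger out-degree
   than [v]; in particular a vertex of maximal out-degree is one, which gives the
   upper bound by querying everything. For the lower bound, take a tournament that
   is regular on [2k+1] vertices, all of which beat the at most one remaining
   vertex, and reverse a uniformly random arc [w -> u] of the regular part. Then
   [u] becomes the unique vertex of maximal out-degree, so the strong kings are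
   among [u] and its in-neighbours: a fixed vertex is a strong king with
   probability at most [(k+1)/(2k+1)], about 1/2. A tree that does not query the
   reversed arc answers as on the unmodified tournament, so it must find a random
   one of about [n^2/2] arcs with constant probability. *)

(** * Strong kings in terms of out-degrees *)

Definition outdeg {n : nat} (G : tournament n) (u : 'I_n) : nat :=
  #|[set w | arc G u w]%SET|.

(** With [Nu] and [Nv] the out-neighbourhoods, [delta G v u] is the size of [Nv] minus [Nu]. The set
    [Nu] minus [Nv] has one element more than [delta G u v], namely [v] itself, which turns the
    strict inequality into a weak one between out-degrees. *)
Lemma delta_lt_outdeg_le (n : nat) (G : tournament n) (u v : 'I_n) :
  arc G u v -> (delta G u v < delta G v u)%N = (outdeg G u <= outdeg G v)%N.
Proof.
move=> Guv.
have neq_uv : u != v by apply: contraTneq Guv => ->; rewrite arcxx.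
have Gvu : arc G v u = false by rewrite (@arc_antisym _ G u v) // Guv.
have arcC a b : a != b -> arc G b a = ~~ arc G a b by exact: arc_antisym.
rewrite /outdeg; set Nu := [set w | arc G u w]%SET; set Nv := [set w | arc G v w]%SET.
have -> : delta G v u = #|Nv :\: Nu|.
  apply: eq_card => w; rewrite !inE andbC.
  have [->|neq_wu] := eqVneq w u; first by rewrite Gvu !andbF.
  by rewrite (arcC u w) // eq_sym.
have duv : #|Nu :\: Nv| = (delta G u v).+1.
  rewrite (cardsD1 v) !inE Guv arcxx add1n; congr _.+1.
  apply: eq_card => w; rewrite !inE.
  have [->|neq_wv] := eqVneq w v; first by rewrite arcxx andbF.
  by rewrite -arcC 1?eq_sym //= andbC.
have := cardsID Nv Nu; have := cardsID Nu Nv; rewrite [Nv :&: Nu]finset.setIC duv; lia.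
Qed.

Lemma STRONG_KING_outdeg (n : nat) (G : tournament n) (v : 'I_n) :
  STRONG_KING G v = [forall u, arc G u v ==> (outdeg G u <= outdeg G v)%N].
Proof.
apply: eq_forallb => u; case: (boolP (arc G u v)) => //= Guv.
exact: delta_lt_outdeg_le.
Qed.

Lemma STRONG_KING_exists (n : nat) (G : tournament n.+1) :
  exists v, STRONG_KING G v.
Proof.
have [v _ vmax] := @arg_maxnP _ (@ord0 n) predT (outdeg G) isT.
exists v; rewrite STRONG_KING_outdeg; apply/forallP => u; apply/implyP => _.
exact: vmax.
Qed.

(** * Decision trees: visible bits, the exhaustive tree, averaging over inputs *)

Section DecisionTreeFacts.
Context {I : finType} {O : choiceType}.
Implicit Types (t : dtree I O).

Fixpoint queried (t : dtree I O) (x : I -> bool) : seq I :=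
  match t with
  | Answer _ => [::]
  | Query i t0 t1 => i :: (if x i then queried t1 x else queried t0 x)
  end.

Lemma size_queried t x : (size (queried t x) <= dtree_depth t)%N.
Proof.
elim: t => //= i t0 IH0 t1 IH1; rewrite ltnS leq_max.
by case: (x i); rewrite ?IH0 ?IH1 ?orbT.
Qed.

Lemma dtree_run_eq_in t (x y : I -> bool) :
  {in queried t x, x =1 y} -> dtree_run t y = dtree_run t x.
Proof.
elim: t => //= i t0 IH0 t1 IH1 eq_xy.
rewrite -(eq_xy i) ?mem_head //.
case: (x i) eq_xy => eq_xy; [apply: IH1|apply: IH0] => j jQ;
  by apply: eq_xy; rewrite inE jQ orbT.
Qed.

(** The argument [x] records the answers received so far; its values on [s] are placeholders that
    get overwritten. *)
Fixpoint query_all (f : {ffun I -> bool} -> O) (s : seq I) (x : {ffun I -> bool}) :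
    dtree I O :=
  match s with
  | [::] => Answer _ (f x)
  | i :: s' => Query i (query_all f s' [ffun j => if j == i then false else x j])
                       (query_all f s' [ffun j => if j == i then true else x j])
  end.

Lemma query_all_depth f s x : dtree_depth (query_all f s x) = size s.
Proof. by elim: s x => //= i s IH x; rewrite !IH maxnn. Qed.

Lemma query_all_run f s (x y : {ffun I -> bool}) :
  (forall i, i \notin s -> x i = y i) -> dtree_run (query_all f s x) y = f y.
Proof.
elim: s x => [|i s IH] x eq_xy /=.
  by congr f; apply/ffunP => i; apply: eq_xy.
case yi: (y i); apply: IH => j jNs; rewrite ffunE; case: eqVneq => [->//|neq_ji];
  by apply: eq_xy; rewrite inE negb_or neq_ji.
Qed.

Variable R : realType.

Lemma depth_le_rdtree_depth (T : rdtree R I O) t :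
  t \in finsupp T -> (dtree_depth t <= rdtree_depth T)%N.
Proof.
by move=> tT; rewrite /rdtree_depth (big_rem t) //= leq_maxl.
Qed.

Definition point_mass (t : dtree I O) : {fsfun dtree I O -> R with 0} :=
  [fsfun [fsfun] with t |-> 1].

Lemma finsupp_point_mass t : finsupp (point_mass t) = [fset t]%fset.
Proof. by rewrite /point_mass finsupp_with oner_eq0 finsupp0 fsetU0. Qed.

Lemma point_mass_ge0 t t' : 0 <= point_mass t t'.
Proof. by rewrite fsfun_withE; case: ifP => // _; rewrite fsfunE. Qed.

Lemma point_mass_sum1 t :
  \sum_(t' <- finsupp (point_mass t)) point_mass t t' = 1.
Proof. by rewrite finsupp_point_mass big_seq_fset1 fsfun_with. Qed.

Definition point_rdtree t : rdtree R I O :=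
  RDTree (@point_mass_ge0 t) (point_mass_sum1 t).

Lemma point_rdtree_depth t : rdtree_depth (point_rdtree t) = dtree_depth t.
Proof. by rewrite /rdtree_depth /= finsupp_point_mass big_seq_fset1. Qed.

Lemma point_rdtree_solves (P : search_problem I O) t :
  (forall x, P x (dtree_run t x)) -> rdtree_solves (point_rdtree t) P.
Proof.
move=> Pt x; rewrite /success_prob /= finsupp_point_mass.
rewrite big_mkcond big_seq_fset1 Pt fsfun_with; lra.
Qed.

(* The easy direction of Yao's principle: averaging over the inputs [X j]. *)
Lemma rdtree_solves_card_le (T : rdtree R I O) (P : search_problem I O)
    (J : finType) (A : {set J}) (X : J -> {ffun I -> bool}) (c : nat) :
  rdtree_solves T P ->
  (forall t, (dtree_depth t <= rdtree_depth T)%N ->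
    (#|[set j in A | P (X j) (dtree_run t (X j))]| <= c)%N) ->
  2 / 3 * #|A|%:R <= c%:R :> R.
Proof.
move=> solT few.
have -> : 2 / 3 * #|A|%:R = \sum_(j in A) (2 / 3 : R).
  by rewrite sumr_const mulr_natr.
apply: (@le_trans _ _ (\sum_(j in A) success_prob T P (X j))).
  by apply: ler_sum => j _; exact: solT.
rewrite /success_prob.
under eq_bigr do rewrite big_mkcond.
have -> : c%:R = \sum_(t <- finsupp T) T t * c%:R.
  by rewrite -mulr_suml rdtree_sum1 mul1r.
(* After the exchange, each tree contributes its mass times the number of [j] in [A] that it answers
   correctly. *)
rewrite exchange_big /=.
rewrite big_seq [leRHS]big_seq; apply: ler_sum => t tT.
rewrite -big_mkcondr /=.
rewrite (eq_bigl (mem [set j in A | P (X j) (dtree_run t (X j))]%SET)); last first.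
  by move=> j; rewrite !inE.
rewrite sumr_const -[leLHS]mulr_natr; apply: ler_wpM2l; first exact: rdtree_ge0.
by rewrite ler_nat few // depth_le_rdtree_depth.
Qed.

End DecisionTreeFacts.

(** * Reversing one arc *)

Section Flip.
Context {n : nat}.
Implicit Types (G : tournament n) (a b u v w : 'I_n) (p : 'I_n * 'I_n).

(** Both orders of [p] are listed because [vpair] stores an arc with its smaller end first, whatever
    its direction. *)
Definition flip G p : tournament n :=
  [ffun q => G q (+) (val q \in [:: p; (p.2, p.1)])].

Lemma arc_flip G p a b :
  arc (flip G p) a b = arc G a b (+) ((a != b) && ((a, b) \in [:: p; (p.2, p.1)])).
Proof.
have memC : ((b, a) \in [:: p; (p.2, p.1)]) = ((a, b) \in [:: p; (p.2, p.1)]).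
  by case: p => x y; rewrite !inE !xpair_eqE /=; do 4!case: (_ == _).
rewrite /arc; case: insubP => [ab lt_ab val_ab|nlt_ab].
  rewrite ffunE val_ab; case: eqVneq lt_ab => [->|//]; by rewrite /= ltnn.
case: insubP => [ba lt_ba val_ba|nlt_ba].
  rewrite ffunE val_ba memC addNb; case: eqVneq lt_ba => [->|//]; by rewrite /= ltnn.
suff -> : a = b by rewrite eqxx.
by apply/val_inj; move: nlt_ab nlt_ba => /=; lia.
Qed.

Lemma outdeg_flip_head G w u :
  arc G w u -> outdeg (flip G (w, u)) u = (outdeg G u).+1.
Proof.
move=> Gwu; have neq_wu : w != u by apply: contraTneq Gwu => ->; rewrite arcxx.
have Guw : arc G u w = false by rewrite (@arc_antisym _ G w u) // Gwu.
rewrite /outdeg (cardsD1 w) !inE arc_flip !inE eqxx Guw eq_sym neq_wu orbT add1n.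
congr _.+1; apply: eq_card => z; rewrite !inE arc_flip !inE /=.
have [->|neq_zw] := eqVneq z w; first by rewrite Guw.
by rewrite !xpair_eqE (negPf neq_zw) [u == w]eq_sym (negPf neq_wu) !andbF addbF.
Qed.

Lemma outdeg_flip_le G w u v :
  arc G w u -> v != u -> (outdeg (flip G (w, u)) v <= outdeg G v)%N.
Proof.
move=> Gwu neq_vu; apply/subset_leq_card/fintype.subsetP => z; rewrite !inE arc_flip !inE.
rewrite !xpair_eqE (negPf neq_vu) orbF.
have [->|_] := eqVneq v w; last by rewrite /= ?andbF ?addbF.
have [->|_] := eqVneq z u; last by rewrite /= ?andbF ?addbF.
by rewrite Gwu.
Qed.

(** The reversal lifts [u] strictly above every other out-degree, so a strong king other than [u]
    must beat [u] in the new tournament. It then beats [u] in [G] as well, since the only arc that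
    changed is the one between [w] and [u]. *)
Lemma STRONG_KING_flip G w u v :
  arc G w u -> (forall z, outdeg G z <= outdeg G u)%N ->
  STRONG_KING (flip G (w, u)) v -> (v == u) || arc G v u.
Proof.
move=> Gwu umax; rewrite STRONG_KING_outdeg => /forallP /(_ u).
have [//|neq_vu] := eqVneq v u.
rewrite outdeg_flip_head // [(_ < _)%N]ltnNge.
rewrite (leq_trans (outdeg_flip_le _ _ _ _ Gwu neq_vu) (umax v)) // implybF.
rewrite arc_flip !inE !xpair_eqE eqxx eq_sym neq_vu (negPf neq_vu) /= andbF /=.
have [->|_] := eqVneq v w; first by rewrite Gwu.
by rewrite addbF => /negPf Guv; rewrite (@arc_antisym _ G u v) 1?eq_sym // Guv.
Qed.

Lemma dtree_run_flip {O : choiceType} (t : dtree (vpair n) O) G p :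
  p \notin [set val q | q in queried t G]%SET ->
  (p.2, p.1) \notin [set val q | q in queried t G]%SET ->
  dtree_run t (flip G p) = dtree_run t G.
Proof.
move=> pNQ p'NQ; apply: dtree_run_eq_in => q qQ; rewrite ffunE !inE.
have vQ : val q \in [set val q | q in queried t G]%SET by exact: imset_f.
have /negPf -> : val q != p by apply: contraNneq pNQ => <-.
have /negPf -> : val q != (p.2, p.1) by apply: contraNneq p'NQ => <-.
by rewrite addbF.
Qed.

(* Only [2 d] of the flips are visible to a tree of depth [d]; on all the others
   the tree gives the same answer as on [G]. *)
Lemma card_STRONG_KING_flip (t : dtree (vpair n) 'I_n) G (E : {set 'I_n * 'I_n}) (c : nat) :
  (forall v, #|[set p in E | STRONG_KING (flip G p) v]| <= c)%N ->
  (#|[set p in E | STRONG_KING (flip G p) (dtree_run t (flip G p))]|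
     <= 2 * dtree_depth t + c)%N.
Proof.
move=> few; set Q : {set 'I_n * 'I_n} := [set val q | q in queried t G]%SET.
pose Q' : {set 'I_n * 'I_n} := [set (p.2, p.1) | p in Q]%SET.
have cQ : (#|Q| <= dtree_depth t)%N.
  apply: leq_trans (leq_imset_card _ _) _.
  by apply: leq_trans (card_size _) (size_queried _ _).
have cQ' : (#|Q'| <= dtree_depth t)%N by exact: leq_trans (leq_imset_card _ _) cQ.
pose S := [set p in E | STRONG_KING (flip G p) (dtree_run t G)]%SET.
apply: (@leq_trans #|(Q :|: Q') :|: S|); last first.
  have := few (dtree_run t G); rewrite -/S.
  have := (leq_card_setU Q Q').1; have := (leq_card_setU (Q :|: Q') S).1; lia.
apply/subset_leq_card/fintype.subsetP => p; rewrite finset.in_setU finset.in_setU !inE => /andP[-> pS].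
have [//|pNQ] := boolP (p \in Q).
have [//|pNQ'] := boolP (p \in Q').
rewrite -(@dtree_run_flip _ t G p) //=.
by apply: contra pNQ' => p'Q; apply/imsetP; exists (p.2, p.1) => //; case: (p).
Qed.

End Flip.

(** * The hard tournament and its regular core *)

Section HardTournament.
Variables (n k : nat).
Hypothesis le_kn : (k.*2 < n)%N.

Definition core : {set 'I_n} := [set v : 'I_n | (v < k.*2.+1)%N]%SET.

(* Inside [core] the smaller of two vertices wins iff their parities differ: this
   is regular because the number [k.*2.+1] of vertices is odd. *)
Definition hard : tournament n :=
  [ffun q : vpair n => ((val q).2 \in core) ==> odd ((val q).1 + (val q).2)%N].

Lemma arc_hard u v :
  arc hard u v = if (u < v)%N then (v \in core) ==> odd (u + v)%N
                 else [&& v < u, u \in core & ~~ odd (u + v)]%N.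
Proof.
rewrite /arc; case: insubP => [uv lt_uv val_uv|nlt_uv].
  by rewrite ffunE val_uv lt_uv.
rewrite (negPf nlt_uv); case: insubP => [vu lt_vu val_vu|/= nlt_vu].
  by rewrite ffunE val_vu /= lt_vu negb_imply addnC.
by rewrite (negPf nlt_vu).
Qed.

Lemma card_core : #|core| = k.*2.+1.
Proof.
rewrite -sum1_card (eq_bigl (fun v : 'I_n => (v < k.*2.+1)%N)); last first.
  by move=> v; rewrite inE.
by rewrite (big_ord_narrow le_kn (F := fun=> 1%N)) sum1_card card_ord.
Qed.

(** The sum counts the vertices below [N] that [u] beats under the parity rule. Stopping at an
    arbitrary [N], before or after [u], makes the induction go through. *)
Lemma parity_sum (u N : nat) :
  (\sum_(0 <= v < N) (if u < v then odd (u + v) else (v < u) && ~~ odd (u + v))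
   = if N <= u then (N + ~~ odd u)./2 else u./2 + (N - u)./2)%N.
Proof.
elim: N => [|N IH]; first by rewrite big_nil leq0n; case: (odd u).
rewrite big_nat_recr //= IH.
have [|] := boolP (odd (u + N)); rewrite oddD;
  case: (boolP (odd u)); case: (boolP (odd N)) => //=;
  case: (leqP N u) => h1; case: (ltnP N u) => h2; case: (ltnP u N) => h3 //=; lia.
Qed.

Lemma card_core_out u : u \in core -> #|[set v in core | arc hard u v]| = k.
Proof.
move=> uC; rewrite -sum1_card.
transitivity (\sum_(v < n | v < k.*2.+1)
   (if u < v then odd (u + v) else (v < u) && ~~ odd (u + v)))%N.
  rewrite [LHS]big_mkcond [RHS]big_mkcond; apply: eq_bigr => v _.
  rewrite !inE arc_hard uC inE; case: (v < k.*2.+1)%N => //=.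
rewrite (big_ord_narrow le_kn (F := fun v : 'I_n =>
  (if u < v then odd (u + v) else (v < u) && ~~ odd (u + v)) : nat)%N) /=.
rewrite -(big_mkord predT (fun v => (if u < v then odd (u + v)
   else (v < u) && ~~ odd (u + v)) : nat)%N) parity_sum.
(* Exactly one of [u] and [k.*2.+1 - u] is odd, so their rounded halves add up to [k]. *)
move: uC; rewrite inE => lt_u; rewrite leqNgt lt_u /=; lia.
Qed.

Lemma card_core_in u : u \in core -> #|[set v in core | arc hard v u]| = k.
Proof.
move=> uC; have := card_core.
rewrite (cardsD1 u) uC -(cardsID [set v | arc hard u v]%SET (core :\ u)).
have -> : #|(core :\ u) :&: [set v | arc hard u v]%SET| = k.
  apply: etrans (card_core_out u uC); apply: eq_card => v; rewrite !inE.
  by case: eqVneq => [->|//]; rewrite arcxx /= andbF.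
have -> : #|(core :\ u) :\: [set v | arc hard u v]%SET| = #|[set v in core | arc hard v u]|.
  apply: eq_card => v; rewrite !inE.
  have [->|neq_vu] := eqVneq v u; first by rewrite arcxx /= !andbF.
  by rewrite (@arc_antisym _ hard u v) 1?eq_sym //= andbC.
lia.
Qed.

Lemma arc_core_out u v : u \in core -> v \notin core -> arc hard u v.
Proof.
move=> uC vC; rewrite arc_hard (negPf vC) /=.
by move: uC vC; rewrite !inE; case: (ltnP u v) => //; lia.
Qed.

Lemma outdeg_core u : u \in core -> outdeg hard u = (k + #|~: core|)%N.
Proof.
move=> uC; rewrite /outdeg -(cardsID core [set w | arc hard u w]%SET).
congr (_ + _)%N.
  by apply: etrans (card_core_out u uC); apply: eq_card => v; rewrite !inE andbC.
apply: eq_card => v; rewrite !inE; case: (boolP (v \in core)) => vC.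
  by move: (vC); rewrite inE => ->.
by rewrite arc_core_out // andbT; move: vC; rewrite inE.
Qed.

Lemma outdeg_hard_le u : (outdeg hard u <= k + #|~: core|)%N.
Proof.
have [uC|uC] := boolP (u \in core); first by rewrite outdeg_core.
apply: leq_trans (leq_addl _ _); apply/subset_leq_card/fintype.subsetP => v.
rewrite finset.in_set finset.in_setC; apply: contraTN => vC.
have neq_uv : v != u by apply: contraNneq uC => <-.
by rewrite (@arc_antisym _ hard v u) // arc_core_out.
Qed.

(** This serves to count arcs grouped by their head, the second component. *)
Lemma card_dep_pairs (A : {set 'I_n}) (B : 'I_n -> {set 'I_n}) (c : nat) :
  {in A, forall u, #|B u| = c} ->
  #|[set p : 'I_n * 'I_n | (p.2 \in A) && (p.1 \in B p.2)]%SET| = (#|A| * c)%N.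
Proof.
move=> cB; rewrite -sum1_card -sum_nat_const -(eq_bigr _ cB).
under [RHS]eq_bigr do rewrite -sum1_card.
rewrite pair_big_dep /= (reindex (fun p : 'I_n * 'I_n => (p.2, p.1))) /=.
  by apply: eq_bigl => p; rewrite inE.
by exists (fun p : 'I_n * 'I_n => (p.2, p.1)) => -[].
Qed.

Definition core_arcs : {set 'I_n * 'I_n} :=
  [set p : 'I_n * 'I_n | (p.2 \in core) && (p.1 \in [set w in core | arc hard w p.2]%SET)]%SET.

Lemma card_core_arcs : #|core_arcs| = (k.*2.+1 * k)%N.
Proof. by rewrite (@card_dep_pairs core (fun u => [set w in core | arc hard w u]%SET) k) ?card_core // => u /card_core_in. Qed.

(** Core vertices have maximal out-degree, so [STRONG_KING_flip] forces the head of the reversed arc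
    to be [v] or an out-neighbour of [v]. The core has at most [k.+1] such heads, and each is the
    head of [k] core arcs. *)
Lemma card_core_arcs_STRONG_KING v :
  (#|[set p in core_arcs | STRONG_KING (flip hard p) v]%SET| <= k.+1 * k)%N.
Proof.
pose A := [set u in core | (v == u) || arc hard v u]%SET.
have cA : (#|A| <= k.+1)%N.
  have [vC|vC] := boolP (v \in core).
    rewrite (cardsD1 v) -add1n leq_add ?leq_b1 //.
    apply: (@leq_trans #|[set u in core | arc hard v u]|); last by rewrite card_core_out.
    apply/subset_leq_card/fintype.subsetP => u; rewrite !inE eq_sym.
    by case: eqVneq.
  (* A vertex outside the core loses to the whole core, so no head is possible. *)
  suff -> : A = finset.set0 by rewrite cards0.
  apply/finset.setP => u; rewrite finset.in_set0; apply/negP; rewrite finset.in_set => /andP[uC].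
  have neq_uv : u != v by apply: contraNneq vC => <-.
  by rewrite eq_sym (negPf neq_uv) (@arc_antisym _ hard u v) // arc_core_out.
apply: leq_trans (leq_mul cA (leqnn k)).
rewrite -(@card_dep_pairs A (fun u => [set w in core | arc hard w u]%SET) k); last first.
  by move=> u; rewrite finset.in_set => /andP[/card_core_in].
apply/subset_leq_card/fintype.subsetP => -[w u]; rewrite finset.in_set => /andP[].
rewrite !finset.in_set /= => /andP[uC /andP[wC wu]] sk.
rewrite wC wu uC /= andbT; apply: STRONG_KING_flip wu _ sk => z.
by rewrite (outdeg_core u) ?outdeg_hard_le // finset.in_set.
Qed.

End HardTournament.

(** * The upper and lower bounds *)

Lemma STRONG_KING_solvable (R : realType) (n : nat) :
  exists2 T : rdtree R (vpair n.+1) 'I_n.+1,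
    rdtree_solves T (@STRONG_KING n.+1) & rdtree_depth T = 'C(n.+1, 2).
Proof.
pose f (G : tournament n.+1) : 'I_n.+1 := xchoose (STRONG_KING_exists n G).
pose t := query_all f (enum {: vpair n.+1}) [ffun=> false].
exists (point_rdtree R t).
  apply: point_rdtree_solves => G; rewrite query_all_run ?/f ?xchooseP //.
  by move=> q; rewrite mem_enum.
by rewrite point_rdtree_depth query_all_depth -cardE card_vpair.
Qed.

Lemma rand_query_complexity_STRONG_KING_ub (R : realType) (n : nat) :
  (0 < n)%N -> (rand_query_complexity R (@STRONG_KING n) <= n ^ 2)%N.
Proof.
case: n => // n _; have [T solT depthT] := STRONG_KING_solvable R n.
have [_ /(_ T solT)] := rand_query_complexityP (ex_intro _ T solT).
rewrite depthT => /leq_trans; apply.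
rewrite bin2 /= -divn2 (leq_trans (leq_div _ _)) //; lia.
Qed.

Lemma rdtree_STRONG_KING_depth (R : realType) (n k : nat)
    (T : rdtree R (vpair n) 'I_n) :
  (k.*2 < n)%N -> rdtree_solves T (@STRONG_KING n) ->
  (k * k <= 6 * rdtree_depth T + k)%N.
Proof.
move=> le_kn solT.
have /= := @rdtree_solves_card_le _ _ R T _ _ (core_arcs n k) (flip (hard n k))
  (2 * rdtree_depth T + k.+1 * k)%N solT.
rewrite card_core_arcs // => bound.
have : 2 / 3 * (k.*2.+1 * k)%:R <= (2 * rdtree_depth T + k.+1 * k)%:R :> R.
  apply: bound => t t_le.
  apply: leq_trans (card_STRONG_KING_flip _ _ _ (k.+1 * k) _) _.
    exact: card_core_arcs_STRONG_KING.
  by rewrite leq_add2r leq_mul2l.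
have -> : 2 / 3 * (k.*2.+1 * k)%:R = (2 * (k.*2.+1 * k))%:R / 3 :> R.
  by rewrite [in RHS]natrM mulrAC.
(* With [d] the depth, the bound reads [2(2k+1)k <= 3(2d + (k+1)k)]. The success rate 2/3 exceeds
   the fraction of about 1/2 that a fixed answer achieves, which leaves a surplus of order [k^2]. *)
rewrite ler_pdivrMr // -natrM ler_nat; lia.
Qed.

Lemma rand_query_complexity_STRONG_KING_lb (R : realType) (n : nat) :
  (8 <= n)%N -> (n ^ 2 <= 81 * rand_query_complexity R (@STRONG_KING n))%N.
Proof.
case: n => // n le8n; have [T0 solT0 _] := STRONG_KING_solvable R n.
have [[T solT <-] _] := rand_query_complexityP (ex_intro _ T0 solT0).
have := @rdtree_STRONG_KING_depth R n.+1 n./2 T.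
have -> : (n./2.*2 < n.+1)%N by lia.
move=> /(_ isT solT).
(* For [k >= 3] one has [k <= k^2 / 3], so [k^2 <= 6d + k] gives [k^2 <= 9d]. Together with
   [n.+1 <= 3k] this yields the constant 81. *)
have : (n.+1 <= 3 * n./2)%N by lia.
have : (3 <= n./2)%N by lia.
move: (n./2) (rdtree_depth T) => k d le3k le_n3k dk; nia.
Qed.

Theorem theorem4p6 (R : realType) :
  (fun n : nat => (rand_query_complexity R (@STRONG_KING n))%:R : R^o)
    =Theta_\oo (fun n : nat => n%:R ^+ 2 : R^o).
Proof.
rewrite eqThetaE qualifE; apply/asboolP; exists (81^-1, 1) => /=.
  by rewrite invr_gt0 ltr01 andbT.
near=> n.
have le8n : (8 <= n)%N by near: n; exact: nbhs_infty_ge.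
rewrite !ger0_norm ?exprn_ge0 // -natrX mul1r ler_pdivrMl // -natrM !ler_nat.
split; first exact: rand_query_complexity_STRONG_KING_lb.
by apply: rand_query_complexity_STRONG_KING_ub; lia.
Unshelve. all: by end_near. Qed.
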